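(* Let $P$ be any $n$-qubit Pauli operator, $\theta\in\mathbb{R}$, $p\in[0,1]$, and consider the channel $\mathcal{N}_{\mathcal P}=(1-p)\mathcal{R}_P(\theta)+p\,\mathcal{P}\circ\mathcal{R}_P(\theta)$. Let $$\varphi=\arcsin[(1-2p)\sin\theta],\qquad s=\frac12\left(1+(1-2p)\frac{\cos\theta}{\cos\varphi}\right)$$ (with $s\in[0,1]$ arbitrary if $\cos\varphi=0$). Then $$\mathcal{N}_{\mathcal P}=s\,\mathcal{R}_P(\varphi)+(1-s)\,\mathcal{R}_P(\pi-\varphi)$$ is a feasible decomposition of $\mathcal{N}_{\mathcal P}$, that is, the identity holds and $0\le s\le1$.
   Context: $\mathcal{R}_P(\vartheta)(\cdot)=R_P(\vartheta)(\cdot)R_P(\vartheta)^\dagger$ with $R_P(\vartheta)=e^{-i\vartheta P/2}$, and $\mathcal{P}(\cdot)=P(\cdot)P^\dagger$, where $P$ is a Hermitian tensor product of single-qubit operators from $\{I,X,Y,Z\}$. A feasible decomposition of a channel is one as a convex combination of unitary channels. *)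

(* Defs.v *)
From HB Require Import structures.
From mathcomp Require Import all_boot all_order all_algebra.
From mathcomp Require Import complex mxtens.
From mathcomp Require Import all_classical all_reals all_analysis.

Set Implicit Arguments.
Unset Strict Implicit.
Unset Printing Implicit Defensive.

Import Order.TTheory GRing.Theory Num.Theory.
Import numFieldNormedType.Exports.

Local Open Scope ring_scope.
Local Open Scope complex_scope.
Local Open Scope sesquilinear_scope.

(* The topology of R[i] is the one given by the complex modulus; matrices over
   R[i] then inherit the topology of entrywise convergence. *)
HB.instance Definition _ (R : rcfType) :=
  PseudoPointedMetric.copy R[i] (R[i])^o.

Inductive pauli := PauliI | PauliX | PauliY | PauliZ.

Section Definitions.
Context {R : realType}.
Local Notation C := R[i].

Definition mx2 (a b c d : C) : 'M[C]_2 :=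
  \matrix_(i < 2, j < 2)
    if i == ord0 then (if j == ord0 then a else b)
    else (if j == ord0 then c else d).

Definition pauli_mx (a : pauli) : 'M[C]_2 :=
  match a with
  | PauliI => mx2 1 0 0 1
  | PauliX => mx2 0 1 1 0
  | PauliY => mx2 0 (- 'i%C) 'i%C 0
  | PauliZ => mx2 1 0 0 (- 1)
  end.

(* 2 ^ m.+1 and 2 * 2 ^ m are not convertible for a variable m. *)
Fixpoint pauli_op (n : nat) : n.-tuple pauli -> 'M[C]_(2 ^ n) :=
  match n with
  | 0 => fun=> 1%:M
  | m.+1 => fun t =>
      castmx (esym (expnS 2 m), esym (expnS 2 m))
        (pauli_mx (thead t) *t pauli_op (behead_tuple t))
  end.

Definition expmx (d : nat) (A : 'M[C]_d) : 'M[C]_d :=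
  limn (series (fun k : nat => (k`!%:R)^-1 *: A ^+ k)).

Definition conj_channel (d : nat) (U : 'M[C]_d) : 'M[C]_d -> 'M[C]_d :=
  fun rho => U *m rho *m U ^t*.

Definition pauli_rot (d : nat) (P : 'M[C]_d) (t : R) : 'M[C]_d :=
  expmx ((- 'i%C * (t / 2)%:C) *: P).

Definition is_unitary_channel (d : nat) (E : 'M[C]_d -> 'M[C]_d) : Prop :=
  exists2 U : 'M[C]_d, U \is unitarymx & E = conj_channel U.

(* An equality of superoperators, using the pointwise module structure on
   functions. *)
Definition feasible_decomposition (d : nat) (N : 'M[C]_d -> 'M[C]_d)
    (k : nat) (w : 'I_k -> R) (E : 'I_k -> 'M[C]_d -> 'M[C]_d) : Prop :=
  [/\ forall j, 0 <= w j,
      \sum_(j < k) w j = 1,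
      forall j, is_unitary_channel (E j)
    & N = \sum_(j < k) (w j)%:C *: E j].

End Definitions.

(* Main.v *)
(** Since [P] is a Hermitian involution, the exponential series splits into
    [R_P(x) = cos (x/2) - i sin (x/2) P], so that
    [R_P(x) rho R_P(x)^t* = (1 + cos x)/2 rho + (1 - cos x)/2 P rho P
                            + i (sin x)/2 (rho P - P rho)].
    A mixture of such channels thus only depends on the mean of [cos] and of
    [sin].  Conjugating by [P] changes the sign of both, hence the noisy channel
    has means [(1 - 2p) cos theta] and [(1 - 2p) sin theta]; the angles [phi] and
    [pi - phi] share the required sine and have opposite cosines, and
    [|(1 - 2p) cos theta| <= cos phi] makes the required mean a convex one. *)

Require Import Defs.
From mathcomp Require Import all_boot all_order all_algebra.
From mathcomp Require Import complex mxtens.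
From mathcomp Require Import all_classical all_reals all_analysis.
From mathcomp Require Import ring lra.
Import Order.TTheory GRing.Theory Num.Theory.
Import numFieldNormedType.Exports.
Local Open Scope ring_scope.
Local Open Scope complex_scope.
Local Open Scope classical_set_scope.

(** * Convergence and separation for complex matrices *)

Lemma real_complex_continuous (R : realType) :
  continuous (real_complex R : R -> R[i]).
Proof.
(* The radius is itself complex; being positive for the order of [R[i]] forces its imaginary part to
   vanish. *)
move=> x; apply/(@cvgrPdist_lt _ (R[i])^o) => -[e e'] /[!ltcE]/= /andP[/eqP-> e0].
near=> y; rewrite -rmorphB/= normc_def/= expr0n/= addr0 sqrtr_sqr ltcR.
near: y; exact: (@cvgr_dist_lt _ R^o _ _ _ id x cvg_id).
Unshelve. all: by end_near. Qed.

(** A basic neighbourhood constrains each entry separately, and finitely many eventual conditions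
    hold simultaneously. *)
Lemma cvg_mx_entrywise (T : topologicalType) m n
    (u : nat -> 'M[T]_(m, n)) (l : 'M[T]_(m, n)) :
  (forall i j, (fun k => u k i j) @ \oo --> l i j) -> u @ \oo --> l.
Proof.
move=> ul A [B lB BA]; rewrite /nbhs/=.
apply: filterS (fun k => BA (u k)) _; rewrite /=.
have : \forall k \near \oo, forall ij : 'I_m * 'I_n, B ij.1 ij.2 (u k ij.1 ij.2).
  by apply: filter_forall => -[i j]; exact: ul (lB i j).
by apply: filterS => k H i j; exact: (H (i, j)).
Qed.

Lemma mx_entry_continuous (T : topologicalType) m n (i : 'I_m) (j : 'I_n) :
  continuous (fun M : 'M[T]_(m, n) => M i j).
Proof.
move=> M A /= MA.
exists (fun i' j' => if (i' == i) && (j' == j) then A else setT) => [i' j'|N /(_ i j)/=].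
  by case: ifPn => [/andP[/eqP-> /eqP->]//|_]; exact: filterT.
by rewrite !eqxx.
Qed.

(** Makes limits unique, so that a convergence proof determines the [limn] in [expmx]. *)
Lemma mx_hausdorff (T : topologicalType) m n :
  hausdorff_space T -> hausdorff_space 'M[T]_(m, n).
Proof.
move=> hT M N MN; apply/matrixP => i j; apply: hT => A B MA NB.
have [K [KA KB]] := MN _ _
  (mx_entry_continuous _ _ _ i j M A MA)
  (mx_entry_continuous _ _ _ i j N B NB).
by exists (K i j).
Qed.

Lemma complex_hausdorff (R : realType) : hausdorff_space (R[i] : topologicalType).
Proof. exact: (@norm_hausdorff _ (R[i])^o). Qed.

Lemma cvg_mx_lincomb (K : numFieldType) m n
    (a b : nat -> K) (x y : K) (A B : 'M[K]_(m, n)) :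
  a @ \oo --> x -> b @ \oo --> y ->
  (fun k => a k *: A + b k *: B) @ \oo --> x *: A + y *: B.
Proof.
move=> ax yb; apply: cvg_mx_entrywise => i j; rewrite !mxE.
rewrite (_ : (fun k => _) = (fun k => a k * A i j + b k * B i j)).
  by apply: cvgD; apply: cvgMl.
by apply/funext => k; rewrite !mxE.
Qed.

(** * Exponential of a multiple of an involution *)

Section expmx_involution.
Context {R : realType} {d : nat}.
Variables (P : 'M[R[i]]_d) (PP : P *m P = 1%:M).

Lemma involution_exp (c : R[i]) k :
  (c *: P) ^+ k = c ^+ k *: (if odd k then P else 1%:M).
Proof.
elim: k => [|k IH]; first by rewrite !expr0 scale1r.
rewrite exprS IH /= -[_ * _]/(_ *m _) -scalemxAl -scalemxAr scalerA -exprS.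
by case: odd; rewrite /= ?PP ?mulmx1.
Qed.

(** Even powers of [P] give the identity and odd ones give [P], while the powers of [- 'i%C] supply
    the alternating signs of the cosine and sine series. *)
Lemma expmx_term (x : R) k :
  (k`!%:R)^-1 *: ((- 'i%C * x%:C) *: P) ^+ k =
  (cos_coeff x k)%:C *: 1%:M + (sin_coeff x k)%:C *: (- 'i%C *: P).
Proof.
rewrite involution_exp exprMn !scalerA /cos_coeff /sin_coeff /= -exprnP.
have iE : (- 'i%C : R[i]) ^+ k = (if odd k then - 'i%C else 1) * (-1) ^+ k./2.
  rewrite -[in LHS](odd_double_half k) exprD -muln2 mulnC exprM sqrrN sqr_i.
  by case: odd => /=; rewrite ?expr1 ?expr0.
rewrite iE.
(* [sin_coeff] takes its sign from [k.-1./2], which equals [k./2] for odd [k]; for even [k] the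
   coefficient is zero. *)
have -> : (k.-1./2 = if odd k then k./2 else k.-1./2)%N.
  case: ifPn => // ok; case: k ok {iE} => //= k ok.
  by rewrite uphalf_half (negbTE ok).
case: odd; rewrite /= ?mul1r ?mul0r ?rmorph0 ?mul0r ?scale0r ?add0r ?addr0;
  congr (_ *: _); rewrite !rmorphM/= !rmorphXn/= ?rmorphN1 fmorphV/= rmorph_nat.
  by ring.
by ring.
Qed.

Lemma expmx_involution (x : R) :
  expmx ((- 'i%C * x%:C) *: P) = (cos x)%:C *: 1%:M + (sin x)%:C *: (- 'i%C *: P).
Proof.
apply: cvg_lim; first exact/mx_hausdorff/complex_hausdorff.
have -> : series (fun k => (k`!%:R)^-1 *: ((- 'i%C * x%:C) *: P) ^+ k) =
   (fun k => (series (cos_coeff x) k)%:C *: 1%:M +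
             (series (sin_coeff x) k)%:C *: (- 'i%C *: P)).
  apply/funext => k; rewrite /series/= !rmorph_sum/= !scaler_suml -big_split/=.
  by apply: eq_bigr => q _; exact: expmx_term.
have c : series (cos_coeff x) @ \oo --> cos x.
  by rewrite unlock; exact: is_cvg_series_cos_coeff.
have s : series (sin_coeff x) @ \oo --> sin x.
  by rewrite unlock; exact: is_cvg_series_sin_coeff.
apply: (@cvg_mx_lincomb R[i]).
  exact: cvg_comp c (real_complex_continuous _ _).
exact: cvg_comp s (real_complex_continuous _ _).
Qed.

End expmx_involution.

Local Open Scope sesquilinear_scope.

(** * Scalar conjugation, dimension casts and tensor identities *)

Lemma conjC_real_complex (R : rcfType) (x : R) : (x%:C)^*%R = x%:C.
Proof. by apply: conj_Creal; rewrite complex_real. Qed.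

Lemma conjC_imaginary (R : rcfType) : ('i%C : R[i])^*%R = - 'i%C.
Proof. by rewrite complexiE conjCi. Qed.

Section cast_square.
Context {C : numClosedFieldType} {a b : nat} (e : a = b).

(** With [b] a variable, [e] can be eliminated by case analysis, unlike the concrete [expnS]
    equation in [pauli_op]. *)
Lemma trmxC_castmx_square (A : 'M[C]_a) :
  (castmx (e, e) A)^t* = castmx (e, e) (A^t*).
Proof. by case: b / e; rewrite !castmx_id. Qed.

Lemma mulmx_castmx_square (A B : 'M[C]_a) :
  castmx (e, e) A *m castmx (e, e) B = castmx (e, e) (A *m B).
Proof. by case: b / e; rewrite !castmx_id. Qed.

Lemma castmx_square1 : castmx (e, e) (1%:M : 'M[C]_a) = 1%:M.
Proof. by case: b / e; rewrite !castmx_id. Qed.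

End cast_square.

Lemma tens1mx1 (K : comPzRingType) m n :
  (1%:M : 'M[K]_m) *t (1%:M : 'M[K]_n) = 1%:M.
Proof.
apply/matrixP => i j; case: (mxtens_indexP i) => i0 i1.
case: (mxtens_indexP j) => j0 j1.
rewrite tensmxE !mxE (can_eq (@mxtens_indexK _ _)) xpair_eqE.
by rewrite -natrM mulnb.
Qed.

(** * Pauli operators are Hermitian involutions *)

Section pauli.
Context {R : realType}.

Lemma pauli_mx_trmxC (a : pauli) : (pauli_mx a : 'M[R[i]]_2)^t* = pauli_mx a.
Proof.
apply/matrixP => -[[|[|//]] ?] [[|[|//]] ?]; rewrite !mxE; case: a; rewrite !mxE /=.
all: by rewrite ?rmorphN/= ?conjC_imaginary ?rmorph0 ?rmorph1 ?opprK.
Qed.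

Lemma pauli_mx_sqr (a : pauli) : pauli_mx a *m pauli_mx a = 1%:M :> 'M[R[i]]_2.
Proof.
have i2 := sqr_i R.
apply/matrixP => -[[|[|//]] ?] [[|[|//]] ?]; rewrite !mxE !big_ord_recl big_ord0.
all: case: a; rewrite !mxE /= ?mulr0n ?mulr1n.
all: by ring: i2.
Qed.

Lemma pauli_op_trmxC n (t : n.-tuple pauli) :
  (pauli_op t : 'M[R[i]]_(2 ^ n))^t* = pauli_op t.
Proof.
elim: n t => [|n IH] t /=; first by rewrite trmx1 map_mx1.
rewrite trmxC_castmx_square; congr castmx.
rewrite trmx_tens map_mxT.
by congr (_ *t _); [exact: pauli_mx_trmxC | exact: IH].
Qed.

Lemma pauli_op_sqr n (t : n.-tuple pauli) :
  pauli_op t *m pauli_op t = 1%:M :> 'M[R[i]]_(2 ^ n).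
Proof.
elim: n t => [|n IH] t /=; first by rewrite mulmx1.
rewrite mulmx_castmx_square tensmx_mul pauli_mx_sqr IH.
by rewrite tens1mx1 castmx_square1.
Qed.

End pauli.

(** * Rotation channels and their mixtures *)

Section rotation_channel.
Context {R : realType} {d : nat}.
Variables (P : 'M[R[i]]_d) (PP : P *m P = 1%:M) (Ph : P^t* = P).

Lemma conj_pauli_rotE (x : R) rho :
  conj_channel (pauli_rot P x) rho =
    ((1 + cos x) / 2)%:C *: rho + ((1 - cos x) / 2)%:C *: (P *m rho *m P) +
    ('i%C * (sin x / 2)%:C) *: (rho *m P - P *m rho).
Proof.
rewrite /conj_channel /pauli_rot expmx_involution//.
(* With [x = y + y], the addition formulas turn the three coefficients into products of [cos y] and
   [sin y]. *)
have -> : x = x / 2 + x / 2 by lra.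
set y := x / 2; have -> : (y + y) / 2 = y by lra.
rewrite cosD sinD.
have c2 := cos2Dsin2 y.
have -> : (1 + (cos y * cos y - sin y * sin y)) / 2 = cos y * cos y by lra.
have -> : (1 - (cos y * cos y - sin y * sin y)) / 2 = sin y * sin y by lra.
have -> : (sin y * cos y + cos y * sin y) / 2 = cos y * sin y by lra.
rewrite linearD/= map_mxD !linearZ/= !map_mxZ Ph trmx1 map_mx1.
rewrite !rmorphM/= !rmorphN/= conjC_imaginary !conjC_real_complex opprK.
rewrite mulmxDl !mulmxDr !mulmxDl -!(scalemxAl, scalemxAr) !mul1mx !mulmx1.
move: (rho *m P) (P *m rho) (P *m rho *m P) => A B D.
rewrite !scalerA scalerBr -!mulrA; have i2 := sqr_i R.
move: ((cos y)%:C) ((sin y)%:C) ('i%C : R[i]) i2 => a b i i2.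
have -> : a * (- i * b) = - (i * (a * b)) by ring.
have -> : a * (i * b) = i * (a * b) by ring.
have -> : - i * (b * (i * b)) = b * b by ring: i2.
by rewrite scaleNr [X in _ + X]addrC addrACA [X in _ + X]addrC.
Qed.

(** The channel sends [1%:M] to the product of the rotation with its adjoint; there the commutator
    vanishes and the two cosine weights add up to 1. *)
Lemma pauli_rot_unitary (x : R) : pauli_rot P x \is unitarymx.
Proof.
apply/unitarymxP; have := conj_pauli_rotE x 1%:M.
rewrite /conj_channel mulmx1 => ->.
rewrite mulmx1 mul1mx PP subrr scaler0 addr0 -scalerDl -rmorphD/=.
have -> : (1 + cos x) / 2 + (1 - cos x) / 2 = 1 by lra.
by rewrite scale1r.
Qed.

(** The hypotheses match the mean sine and cosine of both sides; [2 * s - 1] appears because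
    [pi - phi] has the opposite cosine. *)
Lemma pauli_noise_mixture (theta phi p s : R) :
  sin phi = (1 - 2 * p) * sin theta ->
  (2 * s - 1) * cos phi = (1 - 2 * p) * cos theta ->
  (1 - p)%:C *: conj_channel (pauli_rot P theta) +
    p%:C *: (conj_channel P \o conj_channel (pauli_rot P theta)) =
  s%:C *: conj_channel (pauli_rot P phi) +
    (1 - s)%:C *: conj_channel (pauli_rot P (pi - phi)).
Proof.
move=> sin_phi cos_phi; apply/funext => rho.
have := conj_pauli_rotE.
pose Rot x := conj_channel (pauli_rot P x).
change ((forall x sigma, Rot x sigma = ((1 + cos x) / 2)%:C *: sigma +
    ((1 - cos x) / 2)%:C *: (P *m sigma *m P) +
    ('i%C * (sin x / 2)%:C) *: (sigma *m P - P *m sigma)) ->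
  (1 - p)%:C *: Rot theta rho + p%:C *: (P *m Rot theta rho *m P^t*) =
  s%:C *: Rot phi rho + (1 - s)%:C *: Rot (pi - phi) rho).
(* Kept opaque: unifying rotations of different angles unfolds [expmx]. *)
clearbody Rot => RotE; rewrite !RotE sinB cosB sinpi cospi.
(* Conjugation by [P] swaps [rho] with [P *m rho *m P] and negates the commutator. *)
have conj_rho : P *m (P *m rho *m P) *m P = rho.
  by rewrite !mulmxA PP mul1mx -mulmxA PP mulmx1.
have conj_comm : P *m (rho *m P - P *m rho) *m P = - (rho *m P - P *m rho).
  by rewrite mulmxBr mulmxBl !mulmxA PP mul1mx -!mulmxA PP mulmx1 opprB.
move: (rho *m P - P *m rho) conj_comm => D conj_comm.
rewrite Ph !mulmxDr !mulmxDl -!(scalemxAl, scalemxAr) conj_rho conj_comm.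
move: rho (P *m rho *m P) {conj_rho conj_comm} => A B.
(* Absorbing ['i%C] into [D] leaves only real coefficients, which can then be compared one by
   one. *)
rewrite !['i%C * _]mulrC -!scalerA scalerN; move: ('i%C *: D) => {}D.
rewrite [X in _ *: (X + _ *: - D)]addrC scalerN -scaleNr.
have lincomb2 k l a1 a2 b1 b2 c1 c2 :
    k%:C *: (a1%:C *: A + b1%:C *: B + c1%:C *: D) +
    l%:C *: (a2%:C *: A + b2%:C *: B + c2%:C *: D) =
    (k * a1 + l * a2)%:C *: A + (k * b1 + l * b2)%:C *: B +
    (k * c1 + l * c2)%:C *: D.
  rewrite !scalerDr !scalerA -!rmorphM/= !rmorphD/= !scalerDl addrACA.
  by congr (_ + _); rewrite addrACA.
rewrite -rmorphN/= 2!lincomb2.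
by apply: (f_equal3 (fun a b c : R => a%:C *: A + b%:C *: B + c%:C *: D)); lra.
Qed.

End rotation_channel.

Lemma feasible_decomposition_pair (R : realType) d
    (N E F : 'M[R[i]]_d -> 'M[R[i]]_d) (s : R) :
  0 <= s <= 1 -> is_unitary_channel E -> is_unitary_channel F ->
  N = s%:C *: E + (1 - s)%:C *: F ->
  feasible_decomposition N (fun i : 'I_2 => if i == ord0 then s else 1 - s)
    (fun i : 'I_2 => if i == ord0 then E else F).
Proof.
move=> s01 uE uF ->; split.
- by move=> j; case: ifP => _; lra.
- by rewrite big_ord_recl big_ord1/= addrC subrK.
- by move=> j; case: ifP.
- by rewrite big_ord_recl big_ord1.
Qed.

(** * Bounds for the mixed angle *)

Section angle.
Context {R : realType}.
Variables (q theta : R) (q1 : -1 <= q <= 1).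
Let phi := asin (q * sin theta).

Lemma mixed_sin_itv : -1 <= q * sin theta <= 1.
Proof.
rewrite -ler_norml normrM mulr_ile1// ler_norml//.
by rewrite sin_geN1 sin_le1.
Qed.

Lemma sin_mixed_angle : sin phi = q * sin theta.
Proof. by apply: asinK; rewrite in_itv/=; exact: mixed_sin_itv. Qed.

Lemma cos_mixed_angle_ge0 : 0 <= cos phi.
Proof.
by apply: cos_ge0_pihalf; rewrite asin_geNpi2 ?asin_lepi2 ?mixed_sin_itv.
Qed.

(** Once squared, the two sides differ by exactly [1 - q ^+ 2], which is nonnegative. *)
Lemma norm_mul_cos_le_mixed_angle : `|q * cos theta| <= cos phi.
Proof.
rewrite -ler_sqr ?nnegrE ?cos_mixed_angle_ge0// real_normK ?num_real//.
have -> : (q * cos theta) ^+ 2 =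
    q ^+ 2 * (cos theta ^+ 2 + sin theta ^+ 2) - (q * sin theta) ^+ 2 by ring.
have q2 : q ^+ 2 <= 1 by case/andP: q1 => ? ?; nra.
by rewrite cos2Dsin2 -sin_mixed_angle; have := cos2Dsin2 phi; lra.
Qed.

End angle.

Theorem lemma19 (R : realType) (n : nat) (t : n.-tuple pauli) (theta p s : R) :
  let P : 'M[R[i]]_(2 ^ n) := pauli_op t in
  let Rot (x : R) := conj_channel (pauli_rot P x) in
  let N := (1 - p)%:C *: Rot theta + p%:C *: (conj_channel P \o Rot theta) in
  let phi := asin ((1 - 2 * p) * sin theta) in
  0 <= p <= 1 ->
  (cos phi != 0 -> s = (1 + (1 - 2 * p) * (cos theta / cos phi)) / 2) ->
  (cos phi = 0 -> 0 <= s <= 1) ->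
  [/\ N = s%:C *: Rot phi + (1 - s)%:C *: Rot (pi - phi),
      0 <= s <= 1
    & feasible_decomposition N (fun i : 'I_2 => if i == ord0 then s else 1 - s)
        (fun i : 'I_2 => if i == ord0 then Rot phi else Rot (pi - phi))].
Proof.
move=> P Rot N phi p01 s_cos s_cos0.
have q1 : -1 <= 1 - 2 * p <= 1 by lra.
have sin_phi : sin phi = (1 - 2 * p) * sin theta by exact: sin_mixed_angle.
have cos_phi : `|(1 - 2 * p) * cos theta| <= cos phi.
  by exact: norm_mul_cos_le_mixed_angle.
have [s01 s_eq] : 0 <= s <= 1 /\ (2 * s - 1) * cos phi = (1 - 2 * p) * cos theta.
  have [c0|c0] := eqVneq (cos phi) 0.
    split; first exact: s_cos0.
    (* In the degenerate case the bound [cos_phi] forces [(1 - 2 * p) * cos theta = 0], so any [s]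
       satisfies the equation. *)
    by apply/esym/eqP; rewrite c0 mulr0 -normr_le0 -c0.
  have c_gt0 : 0 < cos phi by rewrite lt_def c0 (le_trans _ cos_phi).
  have s_eq : (2 * s - 1) * cos phi = (1 - 2 * p) * cos theta.
    by rewrite (s_cos c0); field.
  (* Dividing the bound by [cos phi] gives [|2 * s - 1| <= 1], that is, [0 <= s <= 1]. *)
  split=> //; move: cos_phi; rewrite -s_eq normrM (gtr0_norm c_gt0).
  by rewrite ger_pMl// ler_norml => ?; lra.
have PP : P *m P = 1%:M by exact: pauli_op_sqr.
have Ph : P^t* = P by exact: pauli_op_trmxC.
have N_eq : N = s%:C *: Rot phi + (1 - s)%:C *: Rot (pi - phi).
  exact: pauli_noise_mixture.
split; [exact: N_eq | exact: s01 |].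
apply: (feasible_decomposition_pair _ _ _ _ _ _ s01 _ _ N_eq).
  by exists (pauli_rot P phi); [exact: pauli_rot_unitary | reflexivity].
by exists (pauli_rot P (pi - phi)); [exact: pauli_rot_unitary | reflexivity].
Qed.
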